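(* Let $n,k$ be positive integers and let $\mathcal{F}\subseteq[n]^{(k)}$ be intersecting. Then there are sets $M_1\subseteq M_2\subseteq\dots\subseteq M_k\subseteq[n]$ with $\vert M_i\vert\geq n-\sum_{j=i}^{k}j$ for each $i\in[k]$, such that for every $i\in[k]$ and every $A\in M_i^{(i)}$, the family $\mathcal{F}(A)$ is pseudo-intersecting.
   Context: $[n]=\{1,\dots,n\}$ and $X^{(k)}$ denotes the set of $k$-element subsets of $X$. A family $\mathcal{F}$ is intersecting if $F\cap F'\neq\emptyset$ for all $F,F'\in\mathcal{F}$. The shadow of a family $\mathcal{H}$ of sets is $\partial\mathcal{H}=\{H\setminus\{x\}: x\in H\in\mathcal{H}\}$. For $A,B\subseteq[n]$, $\mathcal{F}(A,\overline{B})=\{F\setminus A: F\in\mathcal{F},\ A\subseteq F,\ B\cap F=\emptyset\}$, $\mathcal{F}(A)=\mathcal{F}(A,\overline{\emptyset})$ and $\mathcal{F}(\overline{B})=\mathcal{F}(\emptyset,\overline{B})$. A family $\mathcal{H}$ of subsets of $[n]$ is pseudo-intersecting if $\vert\partial(\mathcal{H}(\overline{X}))\vert\geq\vert\mathcal{H}(\overline{X})\vert$ for all $X\subseteq[n]$, where $\mathcal{H}(\overline{X})=\{H\in\mathcal{H}: H\cap X=\emptyset\}$. (Thus $\mathcal{F}(A)$ is pseudo-intersecting iff $\vert\partial(\mathcal{F}(A,\overline{X\setminus A}))\vert\geq\vert\mathcal{F}(A,\overline{X\setminus A})\vert$ for all $X\subseteq[n]$.) *)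

(* Defs.v *)
From mathcomp Require Import all_boot.

Set Implicit Arguments.
Unset Strict Implicit.
Unset Printing Implicit Defensive.

(* The ground set [n] is represented by 'I_n. *)

Section Families.
Variable T : finType.
Implicit Types (F H : {set {set T}}) (A B X : {set T}).

(* X^(k) *)
Definition ksubsets X (k : nat) : {set {set T}} :=
  [set A : {set T} | A \subset X & #|A| == k].

(* S = S' is allowed, so the members of an intersecting family are nonempty. *)
Definition intersecting F : Prop :=
  forall S S' : {set T}, S \in F -> S' \in F -> S :&: S' != set0.

Definition shadow H : {set {set T}} :=
  [set S :\ x | S in H, x in S].

(* F(A, \bar B) *)
Definition link F A B : {set {set T}} :=
  [set S :\: A | S in F & (A \subset S) && (B :&: S == set0)].

Definition pseudo_intersecting H : Prop :=
  forall X : {set T}, #|link H set0 X| <= #|shadow (link H set0 X)|.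

End Families.

(* Main.v *)
(** Starting from [M_(k+1) = [n]], obtain [M_i] from [M_(i+1)] by deleting one
    [i]-subset [A] for which [F(A)] is not pseudo-intersecting, if there is one.
    It suffices that two disjoint [i]-subsets [A], [B] of [M_(i+1)] cannot both be
    bad.  If [F(A, \bar X)] is larger than its shadow, then so is
    [F(A, \bar (X + b))] for [b] in [B], because [F(A + b)] is pseudo-intersecting;
    so one may take [X] to contain [B], and likewise for [B].  The two resulting
    families are cross-intersecting, and simultaneous shifting shows that one of
    two cross-intersecting families is at most as large as its shadow: once
    the second family is shifted, either all members of one of the families, read
    as up-down paths, go above their starting level, and removing the step that
    first reaches the maximum is an injection into the shadow, or there are
    disjoint members. *)

Require Import Defs.
From mathcomp Require Import all_boot perm zify.

Set Implicit Arguments.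
Unset Strict Implicit.
Unset Printing Implicit Defensive.

Definition cross_intersecting (T : finType) (F G : {set {set T}}) : Prop :=
  forall A B, A \in F -> B \in G -> A :&: B != set0.

Lemma shadowP (T : finType) (F : {set {set T}}) (D : {set T}) :
  reflect (exists A x, [/\ A \in F, x \in A & D = A :\ x]) (D \in shadow F).
Proof.
apply: (iffP imset2P) => [[A x AF xA ->] | [A [x [AF xA ->]]]].
- by exists A, x.
- by exists A x.
Qed.

(** * Shifting *)

Section Shift.
Variables (T : finType) (i j : T).
Implicit Types (F G : {set {set T}}) (A B C D : {set T}).

Let t A : {set T} := tperm i j @: A.

Lemma in_swap A x : (x \in t A) = (tperm i j x \in A).
Proof. by rewrite -{1}(tpermK i j x) mem_imset //; apply: perm_inj. Qed.

Lemma swapK : involutive t.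
Proof. by move=> A; apply/setP => x; rewrite !in_swap tpermK. Qed.

Lemma swap_id A : (i \in A) = (j \in A) -> t A = A.
Proof. by move=> ij; apply/setP => x; rewrite in_swap; case: tpermP => [->|->|]. Qed.

Lemma swap_disjoint A B : A :&: B = set0 -> t A :&: t B = set0.
Proof.
move=> AB0; apply/setP => x; rewrite !inE !in_swap.
by have /setP/(_ (tperm i j x)) := AB0; rewrite !inE.
Qed.

Lemma swapD1 A x : t (A :\ x) = t A :\ tperm i j x.
Proof.
apply/setP => y; rewrite in_swap !inE in_swap.
by rewrite (canF_eq (tpermK i j)).
Qed.

(* The usual shift [j -> i]: of two sets exchanged by the transposition, the one
   containing [i] takes precedence. *)
Definition shift F : {set {set T}} :=
  [set A : {set T} | if i \in A then (A \in F) || (t A \in F) else (A \in F) && (t A \in F)].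

(** Doubling pairs each set with its image under the transposition, so a family and its shift can be
    compared pair by pair, with no choice of orbit representatives. *)
Lemma double_sum_swap F (f : {set T} -> nat) :
  (\sum_(A in F) f A).*2 = \sum_A ((A \in F) * f A + (t A \in F) * f (t A)).
Proof.
rewrite big_split /= -addnn; congr (_ + _).
- by rewrite big_mkcond; apply: eq_bigr => A _; case: (A \in F); rewrite ?mul1n.
- rewrite big_mkcond (reindex_inj (can_inj swapK)) /=.
  by apply: eq_bigr => A _; case: (t A \in F); rewrite ?mul1n.
Qed.

Lemma card_shift F : #|shift F| = #|F|.
Proof.
apply: double_inj; rewrite -!sum1_card !double_sum_swap.
apply: eq_bigr => A _; rewrite !muln1 !inE swapK in_swap tpermL.
case iA: (i \in A); case jA: (j \in A) => //=;
  try (by rewrite (swap_id (etrans iA (esym jA))); case: (A \in F)).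
- by case: (A \in F); case: (t A \in F).
- by case: (A \in F); case: (t A \in F).
Qed.

Lemma swapE A : j \in A -> i \notin A -> t A = i |: (A :\ j).
Proof.
move=> jA iA; apply/setP => x; rewrite in_swap !inE.
case: tpermP => [-> | -> | /eqP xi /eqP xj]; first by rewrite jA eqxx.
- by rewrite (negPf iA) eqxx /= orbF; apply/esym; apply: contraNF iA => /eqP <-.
- by rewrite (negPf xi) xj.
Qed.

(** Makes repeated shifting terminate: no pair increases its contribution, and the pair of [B]
    strictly decreases it. *)
Lemma sum_shift_lt F (f : {set T} -> nat) B :
  (forall A, j \in A -> i \notin A -> f (i |: (A :\ j)) < f A) ->
  B \in F -> j \in B -> i \notin B -> i |: (B :\ j) \notin F ->
  \sum_(A in shift F) f A < \sum_(A in F) f A.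
Proof.
move=> f_lt BF jB iB tBF; rewrite -ltn_double !double_sum_swap.
have tf_lt A : j \in A -> i \notin A -> f (t A) < f A.
  by move=> jA iA; rewrite swapE // f_lt.
rewrite (bigD1 B) //= [X in _ < X](bigD1 B) //= -addSn; apply: leq_add.
  have := tf_lt B jB iB; rewrite -(swapE jB iB) in tBF.
  by rewrite !inE swapK in_swap tpermL jB BF (negPf iB) (negPf tBF) /=; lia.
apply: leq_sum => A _; rewrite !inE swapK in_swap tpermL.
case iA: (i \in A); case jA: (j \in A) => //=;
  try (by rewrite (swap_id (etrans iA (esym jA))); case: (A \in F)).
- have := tf_lt (t A); rewrite !in_swap tpermL tpermR swapK iA jA => /(_ isT isT).
  by case: (A \in F); case: (t A \in F) => //=; lia.
- have := tf_lt A jA (negbT iA).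
  by case: (A \in F); case: (t A \in F) => //=; lia.
Qed.

(** If [C] and [D] are disjoint, one of them misses [i]; that one and its swap both lie in the
    original family. Whichever of the other set and its swap is original is then disjoint from the
    matching one. *)
Lemma shift_cross F G :
  cross_intersecting F G -> cross_intersecting (shift F) (shift G).
Proof.
move=> FG C D; rewrite !inE => CF DG; apply/eqP => CD0.
have tCD0 := swap_disjoint CD0.
have no_disj A B : A \in F -> B \in G -> A :&: B <> set0.
  by move=> AF BG; apply/eqP/FG.
have : ~~ ((i \in C) && (i \in D)) by have /setP/(_ i) := CD0; rewrite !inE => ->.
case: (i \in C) CF; case: (i \in D) DG => //= DG CF _.
- case/andP: DG => DG tDG; case/orP: CF => CF; [exact: no_disj CD0 | exact: no_disj tCD0].
- case/andP: CF => CF tCF; case/orP: DG => DG; [exact: no_disj CD0 | exact: no_disj tCD0].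
- by case/andP: CF => CF _; case/andP: DG => DG _; apply: no_disj CD0.
Qed.

Lemma shadow_shift F : shadow (shift F) \subset shift (shadow F).
Proof.
apply/subsetP => _ /shadowP [C [x [CS xC ->]]].
have inD : C \in F -> C :\ x \in shadow F by move=> CF; apply/shadowP; exists C, x.
have intD : t C \in F -> t (C :\ x) \in shadow F.
  move=> CF; apply/shadowP; exists (t C), (tperm i j x).
  by rewrite in_swap tpermK swapD1.
move: CS; rewrite !inE.
case iC: (i \in C); last by rewrite andbF => /andP[/inD -> /intD ->].
rewrite andbT; case: eqVneq => [ix | _] /=; last first.
  by case/orP => [/inD -> | /intD ->] //; rewrite orbT.
(* Removing [i] itself changes the clause of [shift] that applies: [C :\ i] and its swap must both
   be in the shadow. Either [C] is its own swap, or [C :\ i] is. *)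
subst x; case jC: (j \in C).
  rewrite (swap_id (etrans iC (esym jC))) orbb => CF.
  by rewrite inD //= intD // (swap_id (etrans iC (esym jC))).
have tD : t (C :\ i) = C :\ i by apply: swap_id; rewrite !inE eqxx jC andbF.
by rewrite tD in intD *; rewrite andbb => /orP[/inD | /intD].
Qed.

Lemma card_shadow_shift F :
  #|shift F| <= #|shadow (shift F)| -> #|F| <= #|shadow F|.
Proof.
rewrite card_shift => le_sh; apply: leq_trans le_sh _.
by rewrite -(card_shift (shadow F)); apply/subset_leq_card/shadow_shift.
Qed.

End Shift.

(** * Up-down paths of subsets of an ordered ground set *)

Section CrossShadow.
Variable n : nat.
Implicit Types (F G : {set {set 'I_n}}) (A B : {set 'I_n}).

Definition initial A (m : nat) := #|[set x in A | x < m]|.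

Lemma initialE A m : initial A m = \sum_(x in A) (x < m).
Proof.
rewrite /initial -sum1_card big_mkcond [RHS]big_mkcond /=.
by apply: eq_bigr => x _; rewrite inE; case: (x \in A); case: (x < m).
Qed.

Lemma initialD1 A x m : x \in A -> initial A m = (x < m) + initial (A :\ x) m.
Proof. by move=> xA; rewrite !initialE (big_setD1 x). Qed.

Lemma initialU1 A x m : x \notin A -> initial (x |: A) m = (x < m) + initial A m.
Proof. by move=> xA; rewrite !initialE big_setU1. Qed.

Lemma initialS A (x : 'I_n) : x \notin A -> initial A x.+1 = initial A x.
Proof.
move=> xA; rewrite !initialE; apply: eq_bigr => y yA.
have : y != x by apply: contraNneq xA => <-.
by rewrite -val_eqE /= => yx; congr nat_of_bool; lia.
Qed.

Lemma initialUI A B m :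
  initial A m + initial B m = initial (A :|: B) m + initial (A :&: B) m.
Proof.
rewrite !initialE ![\sum_(x in _) _]big_mkcond -!big_split /=.
by apply: eq_bigr => x _; rewrite !inE; case: (x \in A); case: (x \in B); case: (x < m).
Qed.

Lemma initialT m : m <= n -> initial [set: 'I_n] m = m.
Proof.
move=> mn; have sum1m : \sum_(i < m) 1 = m by rewrite sum1_card card_ord.
rewrite initialE -{2}sum1m (big_ord_widen n (fun=> 1)) // [RHS]big_mkcond /=.
by apply: eq_big => x; rewrite ?inE //; case: (x < m).
Qed.

Lemma eq_initial A B m :
  (forall x : 'I_n, x < m -> (x \in A) = (x \in B)) -> initial A m = initial B m.
Proof.
move=> eqAB; congr #|pred_of_set _|; apply/setP => x; rewrite !inE.
by case xm: (x < m); rewrite ?andbF // eqAB.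
Qed.

Lemma leq_initial A m : m <= n -> initial A m <= m.
Proof.
move=> mn; rewrite -[X in _ <= X](initialT mn); apply/subset_leq_card/subsetP => x.
by rewrite !inE => /andP[].
Qed.

(* The height at time [m] of the path of [A], shifted by [n] to be natural. *)
Definition height A (m : nat) := (initial A m).*2 + (n - m).

(** Step [s] leads from time [s] to time [s.+1], at which the path attains its maximum for the first
    time. *)
Definition is_peak A (s : 'I_n) :=
  [&& s \in A,
      [forall m : 'I_n.+1, height A m <= height A s.+1] &
      [forall m : 'I_n.+1, (m <= s) ==> (height A m < height A s.+1)]].

(** The path starts at height [n] and is higher at time [m], so its first maximum has a positive
    time, and the step into it must go up. *)
Lemma peak_exists A (m : nat) : m <= n -> m < (initial A m).*2 ->
  exists s, is_peak A s.
Proof.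
move=> mn hm.
pose P (u : 'I_n.+1) := [forall v : 'I_n.+1, height A v <= height A u].
have [u1 Pu1] : exists u, P u.
  by case: (arg_maxnP (fun u : 'I_n.+1 => height A u) (erefl (xpredT (ord0 : 'I_n.+1))))
    => u _ max_u; exists u; apply/forallP => v; apply: max_u.
case: (arg_minnP (fun u : 'I_n.+1 => u : nat) Pu1) => u /forallP max_u first_u.
have h0 : height A 0 = n.
  by rewrite /height subn0 initialE big1.
have u_gt0 : 0 < u.
  rewrite lt0n; apply/eqP => u0.
  have m_lt : m < n.+1 by rewrite ltnS.
  have := max_u (Ordinal m_lt); rewrite u0 h0 /height /=; lia.
have s_lt : u.-1 < n by have := ltn_ord u; lia.
pose s := Ordinal s_lt; have su : s.+1 = u :> nat by rewrite /= prednK.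
have lt_s (v : 'I_n.+1) : v <= s -> height A v < height A u.
  move=> vs; rewrite ltn_neqAle max_u andbT; apply/eqP => hv.
  have Pv : P v by apply/forallP => w; rewrite hv.
  by have := first_u _ Pv; rewrite -su ltnNge vs.
exists s; apply/and3P; split.
- apply/negPn/negP => sA.
  have s_lt1 : s < n.+1 by rewrite ltnW // ltnS.
  have := lt_s (Ordinal s_lt1) (leqnn _); rewrite -su /height /=.
  have /= -> := initialS sA; lia.
- by rewrite su; apply/forallP.
- by rewrite su; apply/forallP => v; apply/implyP/lt_s.
Qed.

(** Suppose [s < u] and let $h$ be the height of the common set [A :\ s]. Maximality for [A], tested
    at time [u], gives $h(u)<h(s)$; the first-maximum condition for [B], tested at time [s], gives
    $h(s)\leq h(u)$. *)
Lemma peak_inj A B s u :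
  is_peak A s -> is_peak B u -> A :\ s = B :\ u -> s <= u -> s = u.
Proof.
move=> /and3P[sA /forallP maxA _] /and3P[uB _ /forallP firstB] eqC su.
apply/val_inj/eqP; rewrite eqn_leq su leqNgt /=; apply/negP => lt_su.
have s_lt1 : s < n.+1 by rewrite ltnW // ltnS.
have u_lt1 : u < n.+1 by rewrite ltnW // ltnS.
have hA := maxA (Ordinal u_lt1).
have := firstB (Ordinal s_lt1); rewrite /= su /= => hB.
have sC : s \notin A :\ s by rewrite !inE eqxx.
have uC : u \notin A :\ s by rewrite eqC !inE eqxx.
move: hA hB; rewrite /height /= !(initialD1 _ sA) !(initialD1 _ uB) -eqC.
rewrite !initialS // lt_su !leqnn [u < s]ltnNge su.
rewrite add0n !add1n; have := ltn_ord s; have := ltn_ord u.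
by move: (initial _ s) (initial _ u) => a b; lia.
Qed.

Lemma card_shadow_above F :
  (forall A, A \in F -> exists2 m, m <= n & m < (initial A m).*2) ->
  #|F| <= #|shadow F|.
Proof.
move=> above.
(* The default [A] is never reached on [F], where every path has a peak. *)
pose f A := if [pick s | is_peak A s] is Some s then A :\ s else A.
have fP A : A \in F -> exists2 s, is_peak A s & f A = A :\ s.
  move=> /above[m mn hm]; rewrite /f; case: pickP => [s ps | none]; first by exists s.
  by have [s] := peak_exists mn hm; rewrite none.
rewrite -(card_in_imset (f := f)).
  apply/subset_leq_card/subsetP => _ /imsetP[A AF ->].
  have [s /and3P[sA _ _] ->] := fP A AF.
  by apply/shadowP; exists A, s.
move=> A B /fP[s ps ->] /fP[u pu ->] eqC.
have [sA uB] : s \in A /\ u \in B by case/andP: ps; case/andP: pu.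
suff eq_su : s = u by rewrite -(setD1K sA) -(setD1K uB) eqC eq_su.
case/orP: (leq_total s u) => le_su; first exact: peak_inj ps pu eqC le_su.
exact/esym/(peak_inj pu ps (esym eqC) le_su).
Qed.

(** * Left-shifted families and the shadow alternative for cross-intersecting families *)

Definition left_shifted F := forall (i j : 'I_n) B,
  i < j -> B \in F -> j \in B -> i \notin B -> i |: (B :\ j) \in F.

(** Induction on the size of the intersection: replacing its least element in [B] by a smaller one
    outside both sets keeps the counting hypothesis. *)
Lemma left_shifted_disjoint F A B : left_shifted F -> B \in F ->
  (forall m, m <= n -> initial A m + initial B m <= m) ->
  exists2 C, C \in F & A :&: C = set0.
Proof.
move=> shF; have [c] := ubnP #|A :&: B|.
elim: c B => // c IH B; rewrite ltnS => le_c BF le_init.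
have [AB0 | [x0 x0AB]] := set_0Vmem (A :&: B); first by exists B.
case: (arg_minnP (fun x : 'I_n => x : nat) x0AB) => x xAB min_x.
have /setIP[xA xB] := xAB.
(* Otherwise everything below [x] is covered and [x] is counted twice, so the two counts at [x.+1]
   add up to at least [x + 2]. *)
have [y yx yAB] : exists2 y : 'I_n, y < x & y \notin A :|: B.
  apply/exists_inP; rewrite -[X in is_true X]negbK negb_exists_in; apply/negP => /forall_inP cov.
  have := le_init _ (ltn_ord x).
  have xn : x <= n by rewrite ltnW.
  rewrite (initialD1 _ xA) (initialD1 _ xB) !initialS ?inE ?eqxx // leqnn.
  have : initial (A :|: B) x <= initial A x + initial B x by rewrite initialUI leq_addr.
  rewrite (@eq_initial _ setT) ?initialT //; last by move=> y /cov/negPn ->; rewrite inE.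
  by rewrite (initialD1 _ xA) (initialD1 _ xB) ltnn; lia.
have [yA yB] : y \notin A /\ y \notin B by move: yAB; rewrite inE negb_or => /andP[].
pose C := y |: (B :\ x).
have AC : A :&: C = (A :&: B) :\ x.
  apply/setP => z; rewrite !inE; case: eqVneq => [-> | _] /=.
    by rewrite (negPf yA) andbF.
  by rewrite andbCA.
apply: (IH C).
- apply: leq_trans le_c; by rewrite AC [X in _ < X](cardsD1 x) [x \in _]xAB.
- exact: shF.
(* Up to [x] the sets [A] and [C] have no common element; beyond [x] the exchange does not change
   the count of [B]. *)
- move=> m mn; case: (leqP m x) => mx.
    have -> : initial A m + initial C m = initial (A :|: C) m.
      rewrite initialUI AC [X in _ + X]initialE big1 ?addn0 // => z /setD1P[_ /min_x xz].
      by rewrite ltnNge (leq_trans mx xz).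
    exact: leq_initial.
  have yBx : y \notin B :\ x by rewrite !inE (negPf yB) andbF.
  have := le_init m mn; rewrite initialU1 // (initialD1 m xB) mx.
  by rewrite (ltn_trans yx mx).
Qed.

(** Induction on the total of all elements in the members of [G]: while some shift moves a member of
    [G], it is applied to both families, which stay cross-intersecting. *)
Lemma cross_intersecting_shadow F G : cross_intersecting F G ->
  #|F| <= #|shadow F| \/ #|G| <= #|shadow G|.
Proof.
pose weight G := \sum_(B in G) \sum_(x in B) (x : nat).
have [c] := ubnP (weight G); elim: c F G => // c IH F G; rewrite ltnS => le_c FG.
pose bad (p : 'I_n * 'I_n * {set 'I_n}) := let: (i, j, B) := p in
  [&& i < j, B \in G, j \in B, i \notin B & i |: (B :\ j) \notin G].
case: (pickP bad) => [[[i j] B] /and5P[ij BG jB iB tBG] | good].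
  have [] := IH (shift i j F) (shift i j G); first 2 last.
  - by move/card_shadow_shift; left.
  - by move/card_shadow_shift; right.
  - apply: leq_trans le_c; apply: sum_shift_lt jB iB tBG => // A jA iA.
    rewrite big_setU1 ?inE ?(negPf iA) ?andbF //= [X in _ < X](big_setD1 j) //=.
    by rewrite ltn_add2r.
  - exact: shift_cross.
have shG : left_shifted G.
  move=> i j B ij BG jB iB; have := good (i, j, B).
  by rewrite /bad ij BG jB iB /= => /negbFE.
(* The path of a low set never rises above its start. Low sets in both families satisfy the counting
   hypothesis of [left_shifted_disjoint]. *)
pose low A := [forall m : 'I_n.+1, (initial A m).*2 <= m].
have above (H : {set {set 'I_n}}) : ~~ [exists A in H, low A] -> #|H| <= #|shadow H|.
  rewrite negb_exists_in => /forall_inP noH; apply: card_shadow_above => A /noH.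
  by rewrite negb_forall => /existsP[m]; rewrite -ltnNge; exists m; rewrite -1?ltnS.
case: (boolP [exists A in F, low A]) => [/exists_inP[A AF /forallP lowA] | /above]; last by left.
case: (boolP [exists A in G, low A]) => [/exists_inP[B BG /forallP lowB] | /above]; last by right.
have [|C CG AC0] := left_shifted_disjoint (A := A) shG BG; last first.
  by have := FG _ _ AF CG; rewrite AC0 eqxx.
move=> m; rewrite -ltnS => mn.
by have := lowA (Ordinal mn); have := lowB (Ordinal mn); rewrite /=; lia.
Qed.

End CrossShadow.

(** * Pseudo-intersecting links *)

Section Links.
Variable T : finType.
Implicit Types (F H : {set {set T}}) (A B X : {set T}).

Lemma in_link_link F A X C :
  (C \in link (link F A set0) set0 X) =
  [&& A :&: C == set0, A :|: C \in F & X :&: C == set0].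
Proof.
apply/imsetP/and3P => [[D] | [AC0 ACF XC0]].
- rewrite inE => /and3P[/imsetP[S]]; rewrite inE => /and3P[SF AS _] -> _ XS0 ->.
  rewrite setD0; split => //.
  + by apply/eqP/setP => x; rewrite !inE; case: (x \in A).
  + by rewrite setDE setUIr setUCr setIT (setUidPr AS).
- have eqC : C = (A :|: C) :\: A.
    by rewrite setDUl setDv set0U; apply/esym/setDidPl; rewrite disjoint_sym -setI_eq0.
  exists C; last by rewrite setD0.
  rewrite inE sub0set XC0 /= andbT; apply/imsetP; exists (A :|: C) => //.
  by rewrite !inE ACF subsetUl set0I eqxx.
Qed.

Lemma card_split H b :
  #|H| = #|[set C in H | b \notin C]| + #|[set C :\ b | C in [set C in H | b \in C]]|.
Proof.
rewrite card_in_imset => [|C D /[!inE] /andP[_ bC] /andP[_ bD] eqCD]; last first.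
  by rewrite -(setD1K bC) eqCD setD1K.
rewrite -(cardsID [set C : {set T} | b \in C] H) addnC.
by congr (_ + _); apply: eq_card => C; rewrite !inE // andbC.
Qed.

(** The first shadow consists of sets without [b]; adding [b] to the members of the second gives
    shadow sets with [b], so nothing is counted twice. *)
Lemma card_shadow_split H b :
  #|shadow [set C in H | b \notin C]| +
  #|shadow [set C :\ b | C in [set C in H | b \in C]]| <= #|shadow H|.
Proof.
rewrite (card_split (shadow H) b); apply: leq_add; apply/subset_leq_card/subsetP => D.
- case/shadowP => C [x [/[!inE] /andP[CH bC] xC ->]].
  rewrite !inE (negPf bC) andbF andbT; apply/shadowP; by exists C, x.
- case/shadowP => _ [x [/imsetP[C /[!inE] /andP[CH bC] ->] /[!inE] /andP[xb xC] ->]].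
  apply/imsetP; exists (C :\ x); last by apply/setP => y; rewrite !inE andbCA.
  rewrite !inE bC eq_sym xb !andbT; apply/shadowP; by exists C, x.
Qed.

Definition pseudo_intersectingb H :=
  [forall X : {set T}, #|link H set0 X| <= #|shadow (link H set0 X)|].

Lemma pseudo_intersectingP H : reflect (pseudo_intersecting H) (pseudo_intersectingb H).
Proof. exact: forallP. Qed.

Lemma link_bad_avoid F A B :
  [disjoint A & B] ->
  (forall b, b \in B -> pseudo_intersecting (link F (b |: A) set0)) ->
  ~ pseudo_intersecting (link F A set0) ->
  exists2 X : {set T}, B \subset X &
    #|shadow (link (link F A set0) set0 X)| < #|link (link F A set0) set0 X|.
Proof.
move=> AB psB /pseudo_intersectingP; rewrite negb_forall => /existsP[X0].
pose bad X := #|shadow (link (link F A set0) set0 X)| < #|link (link F A set0) set0 X|.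
rewrite -ltnNge => bad0.
(* A largest bad [X] contains [B]: for a missing [b], the members containing [b] form
   $F(A\cup\{b\},\overline{X})$ once [b] is removed. These do not outnumber their shadow, so the
   members avoiding [b] outnumber theirs. *)
case: (arg_maxnP (P := bad) (fun X : {set T} => #|X|) bad0) => X badX maxX.
exists X => //; apply/subsetP => b bB; apply: contraT => bX.
have bA : b \notin A by rewrite (disjointFl AB bB).
suff /maxX : bad (b |: X) by rewrite /= cardsU1 bX; lia.
set H := link (link F A set0) set0 X.
have eq0 : link (link F A set0) set0 (b |: X) = [set C in H | b \notin C].
  apply/setP => C; rewrite [RHS]inE !in_link_link -!andbA; do 2 congr (_ && _).
  by rewrite setIUl setU_eq0 andbC [[set b] :&: C == _]setI_eq0 disjoints1.
have eq1 : link (link F (b |: A) set0) set0 X = [set C :\ b | C in [set C in H | b \in C]].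
  apply/setP => C; rewrite in_link_link; apply/idP/imsetP.
    rewrite setIUl setU_eq0 [[set b] :&: C == _]setI_eq0 disjoints1.
    case/and3P => /andP[bC AC0] ACF XC0; exists (b |: C); last by rewrite setU1K.
    rewrite inE in_link_link setU11 andbT !setIUr !setU_eq0 AC0 XC0 setUCA setUA.
    by rewrite !(setIC _ [set b]) !setI_eq0 !disjoints1 bA bX ACF.
  case=> D; rewrite inE in_link_link => /andP[/and3P[AD0 ADF XD0] bD] ->.
  have sub Y : Y :&: D == set0 -> Y :&: (D :\ b) == set0.
    by rewrite -!subset0; apply: subset_trans; apply/setIS/subsetDl.
  rewrite setIUl setU_eq0 (sub A AD0) (sub X XD0) [[set b] :&: _ == _]setI_eq0 disjoints1.
  by rewrite !inE eqxx -setUA setUCA setD1K // ADF.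
move: badX; rewrite /bad -/H eq0.
have := psB b bB X; rewrite eq1 (card_split H b) => le1 ltH.
rewrite -(ltn_add2r #|[set C :\ b | C in [set C in H | b \in C]]|).
apply: leq_ltn_trans ltH; apply: leq_trans (card_shadow_split H b).
by rewrite leq_add2l.
Qed.

End Links.

Lemma disjoint_bad_links n (F : {set {set 'I_n}}) (A B : {set 'I_n}) :
  intersecting F -> [disjoint A & B] ->
  (forall b, b \in B -> pseudo_intersecting (link F (b |: A) set0)) ->
  (forall a, a \in A -> pseudo_intersecting (link F (a |: B) set0)) ->
  ~ pseudo_intersecting (link F A set0) -> pseudo_intersecting (link F B set0).
Proof.
move=> intF AB psA psB /(link_bad_avoid AB psA)[X BX badX].
apply/pseudo_intersectingP; apply: contraT => /pseudo_intersectingP.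
rewrite disjoint_sym in AB; case/(link_bad_avoid AB psB) => Y AY badY.
(* Since [X] contains [B] and [Y] contains [A], the intersection of [A :|: C] and [B :|: D] reduces
   to [C :&: D]. *)
suff /cross_intersecting_shadow[] : cross_intersecting
    (link (link F A set0) set0 X) (link (link F B set0) set0 Y).
- by rewrite leqNgt badX.
- by rewrite leqNgt badY.
move=> C D; rewrite !in_link_link => /and3P[AC0 ACF XC0] /and3P[BD0 BDF YD0].
apply: contraNneq (intF _ _ ACF BDF) => CD0.
have BC0 : B :&: C = set0 by apply/eqP; rewrite -subset0 -(eqP XC0) setSI.
have AD0 : A :&: D = set0 by apply/eqP; rewrite -subset0 -(eqP YD0) setSI.
have AB0 : A :&: B = set0 by apply/eqP; rewrite setI_eq0 disjoint_sym.
by rewrite setIUl !setIUr AB0 AD0 CD0 (setIC C) BC0 !setU0.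
Qed.

(** * Descending construction of the sets $M_i$ *)

Section Construction.
Variables (n k : nat) (F : {set {set 'I_n}}).

(** The default [set0] makes the deletion vacuous when no [i]-subset is bad. *)
Definition bad_set (S : {set 'I_n}) (i : nat) : {set 'I_n} :=
  odflt set0 [pick A in ksubsets S i | ~~ pseudo_intersectingb (link F A set0)].

(* [nested d] is the set [M_(k+1-d)]. *)
Fixpoint nested (d : nat) : {set 'I_n} :=
  if d is e.+1 then nested e :\: bad_set (nested e) (k - e) else setT.

Lemma card_bad_set S i : #|bad_set S i| <= i.
Proof.
rewrite /bad_set; case: pickP => [A /andP[] | _] /=; last by rewrite cards0.
by rewrite inE => /andP[_ /eqP ->].
Qed.

Lemma nested_sub d e : d <= e -> nested e \subset nested d.
Proof.
elim: e => [|e IH]; first by rewrite leqn0 => /eqP ->.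
rewrite leq_eqVlt => /predU1P[-> // | /IH]; apply: subset_trans; exact: subsetDl.
Qed.

Lemma card_nested d : d <= k.+1 -> n - \sum_(k.+1 - d <= j < k.+1) j <= #|nested d|.
Proof.
elim: d => [_ | d IH dk]; first by rewrite subn0 big_geq // subn0 cardsT card_ord.
have := IH (ltnW dk); rewrite subSS [\sum_(k - d <= j < _) j]big_ltn; last by lia.
rewrite -subSn //= cardsD.
have := subset_leq_card (subsetIr (nested d) (bad_set (nested d) (k - d))).
have := card_bad_set (nested d) (k - d); lia.
Qed.

Lemma nested_pseudo_intersecting d A :
  F \subset ksubsets [set: 'I_n] k -> intersecting F -> d <= k.+1 ->
  A \in ksubsets (nested d) (k.+1 - d) -> pseudo_intersecting (link F A set0).
Proof.
move=> hF intF; elim: d A => [A _ | d IH A dk].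
  rewrite subn0 inE => /andP[_ /eqP cardA] X.
  (* The induction starts at size [k.+1], where no member of [F] can contain [A]. *)
  suff -> : link (link F A set0) set0 X = set0 by rewrite cards0.
  apply/setP => C; rewrite in_link_link inE; apply/negbTE/negP => /and3P[_ /(subsetP hF)].
  rewrite inE => /andP[_ /eqP cardAC] _.
  by have := subset_leq_card (subsetUl A C); rewrite cardA cardAC ltnn.
rewrite subSS inE /= => /andP[]; rewrite subsetD => /andP[AS Abad] /eqP cardA.
apply/pseudo_intersectingP/negPn/negP => psA; move: Abad; rewrite /bad_set.
case: pickP => [B /andP[] | none]; last by have := none A; rewrite inE AS cardA eqxx psA.
rewrite inE => /andP[BS /eqP cardB] /pseudo_intersectingP psB /= AB.
(* Enlarging a [(k - d)]-subset by one point of [nested d] reaches the size covered by the induction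
   hypothesis. It is applied both ways to [A] and the deleted bad set [B], which [A] avoids. *)
have step (C D : {set 'I_n}) : C \subset nested d -> #|C| = k - d -> D \subset nested d ->
    [disjoint C & D] -> forall b, b \in D -> pseudo_intersecting (link F (b |: C) set0).
  move=> CS cardC DS CD b bD; apply: IH; first exact: ltnW.
  rewrite inE subUset sub1set (subsetP DS) // CS cardsU1 cardC.
  by rewrite (disjointFl CD bD) subSn //=.
have BA : [disjoint B & A] by rewrite disjoint_sym.
have := disjoint_bad_links intF BA (step B A BS cardB AS BA) (step A B AS cardA BS AB) psB.
by move/pseudo_intersectingP; apply/negP.
Qed.

End Construction.

Theorem theorem1p6 (n k : nat) (hn : 0 < n) (hk : 0 < k)
    (F : {set {set 'I_n}})
    (hF : F \subset ksubsets [set: 'I_n] k)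
    (hint : intersecting F) :
  exists M : nat -> {set 'I_n},
    [/\ forall i j : nat, 1 <= i -> i <= j -> j <= k -> M i \subset M j,
        forall i : nat, 1 <= i -> i <= k ->
          n - \sum_(i <= j < k.+1) j <= #|M i|
      & forall i : nat, 1 <= i -> i <= k ->
          forall A : {set 'I_n}, A \in ksubsets (M i) i ->
            pseudo_intersecting (link F A set0)].
Proof.
exists (fun i => nested k F (k.+1 - i)); split => [i j _ ij _ | i _ ik | i _ ik A AM].
- by apply: nested_sub; rewrite leq_sub2l.
- have := card_nested F (leq_subr i k.+1).
  by rewrite subKn // leqW.
- apply: (nested_pseudo_intersecting hF hint (leq_subr i k.+1)).
  by rewrite subKn // leqW.
Qed.
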